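(* Let $(A,\dashv_A,\vdash_A)$ be a diassociative algebra. If $(V,\ell_{\dashv},r_{\dashv},\ell_{\vdash},r_{\vdash})$ is a representation of $(A,\dashv_A,\vdash_A)$, then $(V^*,\,-r^*_{\bullet},\,\ell^*_{\vdash},\,r^*_{\dashv},\,\ell^*_{\bullet})$ is also a representation of $(A,\dashv_A,\vdash_A)$, where $r^*_{\bullet}:=r^*_{\vdash}-r^*_{\dashv}$ and $\ell^*_{\bullet}:=\ell^*_{\vdash}-\ell^*_{\dashv}$.
   Context: All vector spaces are finite-dimensional over a field $\mathbf{k}$ of characteristic $0$. A diassociative algebra is a triple $(A,\dashv_A,\vdash_A)$ consisting of a vector space $A$ and two bilinear operations $\dashv_A,\vdash_A:A\otimes A\to A$ such that for all $x,y,z\in A$ (subscripts omitted): $(x\dashv y)\dashv z=x\dashv(y\dashv z)=x\dashv(y\vdash z)$; $(x\vdash y)\dashv z=x\vdash(y\dashv z)$; $(x\vdash y)\vdash z=(x\dashv y)\vdash z=x\vdash(y\vdash z)$. A representation of $(A,\dashv_A,\vdash_A)$ is a tuple $(V,\ell_{\dashv},r_{\dashv},\ell_{\vdash},r_{\vdash})$ of a vector space $V$ and linear maps $\ell_{\dashv},r_{\dashv},\ell_{\vdash},r_{\vdash}:A\to\mathrm{End}(V)$ (the order matters: left and right actions for $\dashv$, then left and right actions for $\vdash$) such that $A\oplus V$ with the operations $(a+u)\dashv'(b+v)=a\dashv_A b+\ell_{\dashv}(a)v+r_{\dashv}(b)u$ and $(a+u)\vdash'(b+v)=a\vdash_A b+\ell_{\vdash}(a)v+r_{\vdash}(b)u$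 $(a,b\in A,\ u,v\in V)$ is a diassociative algebra. For a linear map $\rho:A\to\mathrm{End}(V)$, the linear map $\rho^*:A\to\mathrm{End}(V^* )$ is given by the transpose (no sign): $\langle\rho^*(x)u^*,v\rangle=\langle u^*,\rho(x)v\rangle$ for $x\in A$, $u^*\in V^*$, $v\in V$. *)

(* Defs.v *)
From HB Require Import structures.
From mathcomp Require Import all_boot all_order all_algebra.

Set Implicit Arguments.
Unset Strict Implicit.
Unset Printing Implicit Defensive.

Import GRing.Theory.

Local Open Scope ring_scope.

(* The binary operations are curried functions, [dl] standing for -| and [dr] *)
(* for |-; bilinearity is part of the predicate.                              *)
Record diassociative (k : fieldType) (A : vectType k) (dl dr : A -> A -> A) :
    Prop := Diassociative {
  dl_linear_l : forall y : A, linear (fun x => dl x y);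
  dl_linear_r : forall x : A, linear (fun y => dl x y);
  dr_linear_l : forall y : A, linear (fun x => dr x y);
  dr_linear_r : forall x : A, linear (fun y => dr x y);
  dl_assoc : forall x y z : A, dl (dl x y) z = dl x (dl y z);
  dl_bar : forall x y z : A, dl x (dl y z) = dl x (dr y z);
  dr_dl_assoc : forall x y z : A, dl (dr x y) z = dr x (dl y z);
  dr_bar : forall x y z : A, dr (dr x y) z = dr (dl x y) z;
  dr_assoc : forall x y z : A, dr (dl x y) z = dr x (dr y z)
}.

Definition semidirect (k : fieldType) (A V : vectType k) (op : A -> A -> A)
    (l r : 'Hom(A, 'End(V))) (p q : A * V) : A * V :=
  (op p.1 q.1, l p.1 q.2 + r q.1 p.2).

Definition representation (k : fieldType) (A : vectType k)
    (dl dr : A -> A -> A) (V : vectType k)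
    (l_dl r_dl l_dr r_dr : 'Hom(A, 'End(V))) : Prop :=
  diassociative (semidirect dl l_dl r_dl) (semidirect dr l_dr r_dr).

Definition dual (k : fieldType) (V : vectType k) : vectType k := 'Hom(V, k^o).

(* [linfun] is meaningful only on linear maps; this is justified, together    *)
(* with the pairing formula defining rho^*, by [dual_actionE] below.          *)
Definition dual_action (k : fieldType) (A V : vectType k)
    (rho : 'Hom(A, 'End(V))) : 'Hom(A, 'End(dual V)) :=
  linfun (fun x : A => linfun (fun u : 'Hom(V, k^o) => (u \o rho x)%VF)
                       : 'End(dual V)).

Lemma dual_actionE (k : fieldType) (A V : vectType k)
    (rho : 'Hom(A, 'End(V))) (x : A) (u : 'Hom(V, k^o)) (v : V) :
  (dual_action rho x u : 'Hom(V, k^o)) v = u (rho x v).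
Proof.
have linU y : linear (fun w : 'Hom(V, k^o) => (w \o rho y)%VF).
  move=> a w w'; apply/lfunP => t.
  by rewrite !(comp_lfunE, add_lfunE, scale_lfunE).
pose T y := linfun (fun w : 'Hom(V, k^o) => (w \o rho y)%VF).
have TE y w : T y w = (w \o rho y)%VF.
  pose h := GRing.isLinear.Build _ _ _ _ _ (linU y).
  pose f : {linear 'Hom(V, k^o) -> 'Hom(V, k^o)} :=
    HB.pack (fun w : 'Hom(V, k^o) => (w \o rho y)%VF) h.
  exact: (lfunE f).
have linT : linear (T : A -> 'End(dual V)).
  move=> a y y'; apply/lfunP => w; rewrite add_lfunE scale_lfunE !TE.
  by apply/lfunP => t; rewrite add_lfunE scale_lfunE !comp_lfunE linearP
    add_lfunE scale_lfunE linearP.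
pose h := GRing.isLinear.Build _ _ _ _ _ linT.
pose f : {linear A -> 'End(dual V)} := HB.pack (T : A -> 'End(dual V)) h.
have -> : dual_action rho x = T x by exact: (lfunE f).
by rewrite TE comp_lfunE.
Qed.

(* Main.v *)
Require Import Defs.
From mathcomp Require Import all_boot all_order all_algebra.

Import GRing.Theory.

Local Open Scope ring_scope.

(* On the semidirect product each diassociativity axiom splits, according to  *)
(* which argument lies in V, into identities between composed actions. The    *)
(* transpose reverses compositions, so on V* one needs the identities of V    *)
(* with factors swapped; the cross terms vanish because composing any r_dr x  *)
(* or l_dl x after r_dr y - r_dl y or l_dr y - l_dl y gives 0.                *)

(** By [representationP], both hypothesis and conclusion become 15 identities between actions; by
    [dual_actionE] and [dual_actionB], each one on V* reduces to an identity on V. For instance,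
    [dl_assoc_xy_v] on V* reads ([r_dl] y - [r_dr] y)([r_dl] x - [r_dr] x) = ([r_dl] - [r_dr])([dl]
    x y): the outer [r_dr] y kills the difference, and [r_dl] y carries it to the right-hand
    side. *)

Section Semidirect.

Set Implicit Arguments.
Unset Strict Implicit.

Variables (k : fieldType) (A V : vectType k).
Implicit Types (op : A -> A -> A) (l r : 'Hom(A, 'End(V))).

(* The fields [xy_v], [x_v_z], [v_yz] of each axiom are its components where  *)
(* the third, second, first argument lies in V and the others in A.           *)
Record compatible_actions (dl dr : A -> A -> A)
    (l_dl r_dl l_dr r_dr : 'Hom(A, 'End(V))) : Prop := CompatibleActions {
  dl_assoc_xy_v x y v : l_dl (dl x y) v = l_dl x (l_dl y v);
  dl_assoc_x_v_z x z v : r_dl z (l_dl x v) = l_dl x (r_dl z v);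
  dl_assoc_v_yz y z v : r_dl z (r_dl y v) = r_dl (dl y z) v;
  dl_bar_xy_v x y v : l_dl x (l_dl y v) = l_dl x (l_dr y v);
  dl_bar_x_v_z x z v : l_dl x (r_dl z v) = l_dl x (r_dr z v);
  dl_bar_v_yz y z v : r_dl (dl y z) v = r_dl (dr y z) v;
  dr_dl_assoc_xy_v x y v : l_dl (dr x y) v = l_dr x (l_dl y v);
  dr_dl_assoc_x_v_z x z v : r_dl z (l_dr x v) = l_dr x (r_dl z v);
  dr_dl_assoc_v_yz y z v : r_dl z (r_dr y v) = r_dr (dl y z) v;
  dr_bar_xy_v x y v : l_dr (dr x y) v = l_dr (dl x y) v;
  dr_bar_x_v_z x z v : r_dr z (l_dr x v) = r_dr z (l_dl x v);
  dr_bar_v_yz y z v : r_dr z (r_dr y v) = r_dr z (r_dl y v);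
  dr_assoc_xy_v x y v : l_dr (dl x y) v = l_dr x (l_dr y v);
  dr_assoc_x_v_z x z v : r_dr z (l_dl x v) = l_dr x (r_dr z v);
  dr_assoc_v_yz y z v : r_dr z (r_dl y v) = r_dr (dr y z) v
}.

Lemma semidirect_linear_l op l r :
    (forall y, linear (fun x => op x y)) ->
  forall q, linear (fun p => semidirect op l r p q).
Proof.
move=> op_lin [b v] a [x u] [x' u']; rewrite /semidirect /=; congr pair.
  exact: op_lin.
rewrite /= !linearP add_lfunE scale_lfunE scalerDr.
by rewrite -!addrA; congr (_ + _); rewrite addrCA.
Qed.

Lemma semidirect_linear_r op l r :
    (forall x, linear (fun y => op x y)) ->
  forall p, linear (fun q => semidirect op l r p q).
Proof.
move=> op_lin [b v] a [x u] [x' u']; rewrite /semidirect /=; congr pair.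
  exact: op_lin.
rewrite /= !linearP add_lfunE scale_lfunE scalerDr.
by rewrite -!addrA; congr (_ + _); rewrite addrCA.
Qed.

(** This and [semidirect_mulA_r] list the V-terms in the same order (third, second, first argument
    in V), so that two bracketings can be compared term by term. *)
Lemma semidirect_mulA_l op op' l r l' r' p q s :
  semidirect op l r (semidirect op' l' r' p q) s =
  (op (op' p.1 q.1) s.1,
   l (op' p.1 q.1) s.2 + (r s.1 (l' p.1 q.2) + r s.1 (r' q.1 p.2))).
Proof. by rewrite /semidirect /= linearD. Qed.

Lemma semidirect_mulA_r op op' l r l' r' p q s :
  semidirect op l r p (semidirect op' l' r' q s) =
  (op p.1 (op' q.1 s.1),
   l p.1 (l' q.1 s.2) + (l p.1 (r' s.1 q.2) + r (op' q.1 s.1) p.2)).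
Proof. by rewrite /semidirect /= linearD addrA. Qed.

(** Products of two elements of V vanish, so each V-component is a sum of three terms; setting the
    other V-entries to 0 isolates one of them. The A-components are the axioms of A. *)
Lemma representationP (dl dr : A -> A -> A)
    (l_dl r_dl l_dr r_dr : 'Hom(A, 'End(V))) : diassociative dl dr ->
  representation dl dr l_dl r_dl l_dr r_dr <->
  compatible_actions dl dr l_dl r_dl l_dr r_dr.
Proof.
pose semidirect_mulA := (semidirect_mulA_l, semidirect_mulA_r).
case=> linll linlr linrl linrr A1 A2 A3 A4 A5; split.
  case=> _ _ _ _ B1 B2 B3 B4 B5.
  split=> x y v;
    [ have:= B1 (x, 0) (y, 0) (0, v)
    | have:= B1 (x, 0) (0, v) (y, 0)
    | have:= B1 (0, v) (x, 0) (y, 0)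
    | have:= B2 (x, 0) (y, 0) (0, v)
    | have:= B2 (x, 0) (0, v) (y, 0)
    | have:= B2 (0, v) (x, 0) (y, 0)
    | have:= B3 (x, 0) (y, 0) (0, v)
    | have:= B3 (x, 0) (0, v) (y, 0)
    | have:= B3 (0, v) (x, 0) (y, 0)
    | have:= B4 (x, 0) (y, 0) (0, v)
    | have:= B4 (x, 0) (0, v) (y, 0)
    | have:= B4 (0, v) (x, 0) (y, 0)
    | have:= B5 (x, 0) (y, 0) (0, v)
    | have:= B5 (x, 0) (0, v) (y, 0)
    | have:= B5 (0, v) (x, 0) (y, 0) ];
  by rewrite !semidirect_mulA /= !linear0 ?addr0 ?add0r => -[].
case=> a1 a2 a3 b1 b2 b3 c1 c2 c3 d1 d2 d3 e1 e2 e3.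
split; try exact: semidirect_linear_l; try exact: semidirect_linear_r;
  move=> p q s; rewrite !semidirect_mulA.
- by rewrite A1 a1 a2 a3.
- by rewrite A2 b1 b2 b3.
- by rewrite A3 c1 c2 c3.
- by rewrite A4 d1 d2 d3.
- by rewrite A5 e1 e2 e3.
Qed.

End Semidirect.

Section Dual.

Set Implicit Arguments.
Unset Strict Implicit.

Variables (k : fieldType) (A V : vectType k).
Implicit Types (rho sigma : 'Hom(A, 'End(V))) (u : dual V).

(** Makes each action on V* the transpose of a single action, so that evaluation at a vector has the
    form u(w). *)
Lemma dual_actionB rho sigma :
  dual_action (rho - sigma) = dual_action rho - dual_action sigma.
Proof.
apply/lfunP=> x; rewrite !lfun_simp; apply/lfunP=> u; rewrite !lfun_simp.
apply/(@lfunP _ V k^o)=> v; rewrite [RHS]add_lfunE opp_lfunE !dual_actionE.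
by rewrite !lfun_simp linearB.
Qed.

End Dual.

Theorem proposition2p12 (k : fieldType) (char_k : [pchar k] =i pred0)
    (A : vectType k) (dl dr : A -> A -> A) (diassA : diassociative dl dr)
    (V : vectType k) (l_dl r_dl l_dr r_dr : 'Hom(A, 'End(V))) :
  representation dl dr l_dl r_dl l_dr r_dr ->
  representation dl dr (V := dual V)
    (- (dual_action r_dr - dual_action r_dl)) (dual_action l_dr)
    (dual_action r_dl) (dual_action l_dr - dual_action l_dl).
Proof.
move/(representationP _ _ _ _ diassA).
(* Letters follow the five axioms; digits 1, 2, 3 mean that the third, second, first argument lies
   in V. *)
case=> a1 a2 a3 b1 b2 b3 c1 c2 c3 d1 d2 d3 e1 e2 e3.
rewrite opprB -!dual_actionB; apply/(representationP _ _ _ _ diassA).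
(* Both sides are now u of a vector of V, with the actions composed in reverse order, so equality in
   V suffices. *)
split=> x y u; apply/(@lfunP _ V k^o)=> v; rewrite !dual_actionE; congr (u _);
  rewrite ?lfun_simp ?linearB /=.
- by rewrite -a3 -c3 d3 subrr addr0.
- by rewrite c2 d2 e2.
- by rewrite e1.
- by rewrite d3 subrr addr0.
- by rewrite b2 subrr addr0.
- by rewrite d1.
- by rewrite -b3 -a3 -e3.
- by rewrite c2.
- by rewrite e1 a1 -b1.
- by rewrite b3.
- by rewrite d2 subrr addr0.
- by rewrite b1 subrr addr0.
- by rewrite a3.
- by rewrite d2 subrr addr0 c2 a2.
- by rewrite d1 e1 c1.
Qed.
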